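(* Let $n\geq 0$ be an integer and let $x$ be a complex number for which every denominator and every base raised to a negative power below is nonzero (this is the case whenever $x\notin\{0,\pm1,\pm\tfrac{1}{\sqrt2},\pm 2i,\pm i\sqrt2\}$). Then $$x\sum_{k=0}^{n-1}\binom{n}{k}\Bigl(\frac{\sqrt{x^2+4}\,(2x^3-x)}{x^2+2}\Bigr)^{n-k-1}\bigl(1-(-1)^{n-k}\bigr)T_{2k}(x)$$ $$=\bigl(2x\sqrt{x^2-1}\bigr)^{n-1}\sum_{k=1}^{n}\binom{n}{k}\Bigl(\frac{2x^2-1}{(x^3+2x)\sqrt{x^2-1}}\Bigr)^{k-1}\bigl(1+(-1)^{n-k}\bigr)F_{2k}(x)$$ and $$\frac12\sum_{k=0}^{n}\binom{n}{k}\Bigl(\frac{\sqrt{x^2+4}\,(2x^3-x)}{x^2+2}\Bigr)^{n-k-1}\bigl(1-(-1)^{n-k}\bigr)U_{2k}(x)$$ $$=\bigl(2x\sqrt{x^2-1}\bigr)^{n-2}\sum_{k=1}^{n}\binom{n}{k}\Bigl(\frac{2x^2-1}{(x^3+2x)\sqrt{x^2-1}}\Bigr)^{k-1}\bigl(\alpha(x)-(-1)^{n-k}\beta(x)\bigr)F_{2k}(x).$$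
   Context: The Chebyshev polynomials of the first kind $T_n(x)$ and of the second kind $U_n(x)$ are defined by $T_0(x)=1$, $T_1(x)=x$, $T_{n+1}(x)=2xT_n(x)-T_{n-1}(x)$, and $U_0(x)=1$, $U_1(x)=2x$, $U_{n+1}(x)=2xU_n(x)-U_{n-1}(x)$ for $n\ge 1$. The (Catalan) Fibonacci polynomials $F_n(x)$ are defined by $F_0(x)=0$, $F_1(x)=1$, $F_n(x)=xF_{n-1}(x)+F_{n-2}(x)$ for $n\geq 2$. Put $\alpha(x)=x+\sqrt{x^2-1}$ and $\beta(x)=x-\sqrt{x^2-1}$. Here $\sqrt{x^2-1}$ and $\sqrt{x^2+4}$ denote fixed complex square roots, the same choice being used throughout. Conventions: $0^0=1$, and a sum whose upper limit is smaller than its lower limit is $0$. *)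

(* Defs.v *)
From mathcomp Require Import all_boot all_order all_algebra.
From mathcomp Require Import reals complex.
Set Implicit Arguments.
Unset Strict Implicit.
Unset Printing Implicit Defensive.
Import Order.TTheory GRing.Theory Num.Theory.
Local Open Scope ring_scope.

Fixpoint chebT (K : nzRingType) (n : nat) : {poly K} :=
  match n with
  | 0%N => 1
  | 1%N => 'X
  | (m.+1 as m1).+1 => 2%:R * 'X * chebT K m1 - chebT K m
  end.

Fixpoint chebU (K : nzRingType) (n : nat) : {poly K} :=
  match n with
  | 0%N => 1
  | 1%N => 2%:R * 'X
  | (m.+1 as m1).+1 => 2%:R * 'X * chebU K m1 - chebU K m
  end.

Fixpoint fibp (K : nzRingType) (n : nat) : {poly K} :=
  match n with
  | 0%N => 0
  | 1%N => 1
  | (m.+1 as m1).+1 => 'X * fibp K m1 + fibp K m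
  end.

(* Square roots are not computed by a fixed branch: below, s stands for any  *)
(* chosen square root of x^2 - 1 and r for any chosen square root of x^2 + 4. *)

Definition alpha (K : nzRingType) (x s : K) : K := x + s.
Definition beta (K : nzRingType) (x s : K) : K := x - s.

Definition chebBase (K : fieldType) (x r : K) : K :=
  r * (2%:R * x ^+ 3 - x) / (x ^+ 2 + 2%:R).

Definition fibBase (K : fieldType) (x s : K) : K :=
  (2%:R * x ^+ 2 - 1) / ((x ^+ 3 + 2%:R * x) * s).

(* The first two conditions are the denominators of chebBase and fibBase.    *)
(* In the identities chebBase is raised to the power n - k - 1, which is -1  *)
(* at k = n, and 2 x s to the powers n - 1 and n - 2; fibBase only occurs    *)
(* with exponents k - 1 >= 0, so it is allowed to vanish.                    *)
Definition admissible (K : fieldType) (x s r : K) : Prop :=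
  [/\ x ^+ 2 + 2%:R != 0, (x ^+ 3 + 2%:R * x) * s != 0,
      chebBase x r != 0 & 2%:R * x * s != 0].

(* Main.v *)
Require Import Defs.
From mathcomp Require Import all_boot all_order all_algebra.
From mathcomp Require Import reals complex ring.
Set Implicit Arguments.
Unset Strict Implicit.
Unset Printing Implicit Defensive.
Import Order.TTheory GRing.Theory Num.Theory.
Local Open Scope ring_scope.

(* Both members are evaluated in closed form. Put u = 2x^2 - 1, v = 2xs, so that
   alpha^2 = u + v and beta^2 = u - v, and let c = chebBase, f = fibBase and
   p, q = ((x +- r) / 2)^2. The Binet formulas turn T_{2k} and U_{2k} into
   combinations of (u + v)^k and (u - v)^k, and F_{2k} into (p^k - q^k) / r,
   where v f p = u + c and v f q = u - c. By the binomial theorem all the sums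
   become combinations of the four powers (u +- v +- c)^n, and these agree. *)

(** * Binet formulas *)

(** Here [a] and [b] are the roots of t^2 - 2xt + 1, so their powers obey the recurrence of T; the
    induction carries two consecutive indices. The factor 2 stays on the left because [K] is only a
    ring. U, and F with t^2 - xt - 1, are treated in the same way. *)
Lemma chebT_binet (K : comNzRingType) (x a b : K) (n : nat) :
  a + b = 2%:R * x -> a * b = 1 ->
  2%:R * (chebT K n).[x] = a ^+ n + b ^+ n.
Proof.
move=> hD hM.
suff: 2%:R * (chebT K n).[x] = a ^+ n + b ^+ n /\
      2%:R * (chebT K n.+1).[x] = a ^+ n.+1 + b ^+ n.+1 by case.
elim: n => [|n [IH0 IH1]].
  by split; rewrite /= ?hornerE ?expr0 ?expr1 ?hD //; ring.
split=> //.
have -> : (chebT K n.+2).[x] = 2%:R * x * (chebT K n.+1).[x] - (chebT K n).[x].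
  (* Writing the leading factor as the scaling [2%:R *: 'X] lets [hornerE] evaluate it to
     [2%:R * x]. *)
  rewrite (_ : chebT K n.+2 = 2%:R *: 'X * chebT K n.+1 - chebT K n) ?hornerE //.
  by rewrite scaler_nat -mulr_natl.
have -> : 2%:R * (2%:R * x * (chebT K n.+1).[x] - (chebT K n).[x]) =
  (a + b) * (2%:R * (chebT K n.+1).[x]) - a * b * (2%:R * (chebT K n).[x]).
  by rewrite hD hM; ring.
by rewrite IH0 IH1 !exprS; ring.
Qed.

Lemma chebU_binet (K : comNzRingType) (x a b : K) (n : nat) :
  a + b = 2%:R * x -> a * b = 1 ->
  (a - b) * (chebU K n).[x] = a ^+ n.+1 - b ^+ n.+1.
Proof.
move=> hD hM.
suff: (a - b) * (chebU K n).[x] = a ^+ n.+1 - b ^+ n.+1 /\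
      (a - b) * (chebU K n.+1).[x] = a ^+ n.+2 - b ^+ n.+2 by case.
elim: n => [|n [IH0 IH1]].
  rewrite (_ : chebU K 1 = 2%:R *: 'X); last by rewrite scaler_nat -mulr_natl.
  by rewrite hornerZ hornerX -hD /= hornerE; split; ring.
split=> //.
have -> : (chebU K n.+2).[x] = 2%:R * x * (chebU K n.+1).[x] - (chebU K n).[x].
  rewrite (_ : chebU K n.+2 = 2%:R *: 'X * chebU K n.+1 - chebU K n) ?hornerE //.
  by rewrite scaler_nat -mulr_natl.
have -> : (a - b) * (2%:R * x * (chebU K n.+1).[x] - (chebU K n).[x]) =
  (a + b) * ((a - b) * (chebU K n.+1).[x])
  - a * b * ((a - b) * (chebU K n).[x]).
  by rewrite hD hM; ring.
by rewrite IH0 IH1 !exprS; ring.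
Qed.

Lemma fibp_binet (K : comNzRingType) (x a b : K) (n : nat) :
  a + b = x -> a * b = -1 -> (a - b) * (fibp K n).[x] = a ^+ n - b ^+ n.
Proof.
move=> hD hM.
suff: (a - b) * (fibp K n).[x] = a ^+ n - b ^+ n /\
      (a - b) * (fibp K n.+1).[x] = a ^+ n.+1 - b ^+ n.+1 by case.
elim: n => [|n [IH0 IH1]].
  by split; rewrite /= ?hornerE; ring.
split=> //.
have -> : (fibp K n.+2).[x] = x * (fibp K n.+1).[x] + (fibp K n).[x].
  by rewrite (_ : fibp K n.+2 = 'X * fibp K n.+1 + fibp K n) ?hornerE.
have -> : (a - b) * (x * (fibp K n.+1).[x] + (fibp K n).[x]) =
  (a + b) * ((a - b) * (fibp K n.+1).[x])
  - a * b * ((a - b) * (fibp K n).[x]).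
  by rewrite hD hM; ring.
by rewrite IH0 IH1 !exprS; ring.
Qed.

(** * Binomial sums with alternating weights *)

(** The sign (-1)^(n-k) is absorbed into w^(n-k), which becomes (-w)^(n-k); each weight then gives
    an ordinary binomial expansion. *)
Lemma binomial_sign_sum (K : comNzRingType) (n : nat) (g h w z : K) :
  \sum_(0 <= k < n.+1)
     'C(n, k)%:R * w ^+ (n - k) * (g + (-1) ^+ (n - k) * h) * z ^+ k
  = g * (w + z) ^+ n + h * (- w + z) ^+ n.
Proof.
rewrite !exprDn !mulr_sumr -big_split /= big_mkord.
apply: eq_bigr => i _; rewrite [(- w) ^+ _]exprNn.
by rewrite -!(mulr_natl (_ * _) 'C(n, i)); ring.
Qed.

Lemma exprz_subn1 (K : fieldType) (c : K) (m : nat) :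
  c != 0 -> c ^ (m%:Z - 1) = c ^+ m / c.
Proof. by move=> c0; rewrite expfzDr. Qed.

(** The integer exponent n - k - 1 drops to -1 at k = n, so one factor 1/c is split off, leaving a
    natural exponent. *)
Lemma binomial_sign_sum_subexp (K : fieldType) (n : nat) (g h c y : K) :
  c != 0 ->
  \sum_(0 <= k < n.+1)
     'C(n, k)%:R * c ^ (n%:Z - k%:Z - 1) * (g + (-1) ^+ (n - k) * h) * y ^+ k
  = (g * (c + y) ^+ n + h * (- c + y) ^+ n) / c.
Proof.
move=> c0; rewrite -binomial_sign_sum mulr_suml.
apply: eq_big_nat => k /andP[_ kn].
by rewrite subzn // exprz_subn1 //; ring.
Qed.

Lemma binomial_sign_sum_subexp2 (K : fieldType) (n : nat) (g h c a y b z : K) :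
  c != 0 ->
  \sum_(0 <= k < n.+1)
     'C(n, k)%:R * c ^ (n%:Z - k%:Z - 1) * (g + (-1) ^+ (n - k) * h)
     * (a * y ^+ k + b * z ^+ k)
  = (a * (g * (c + y) ^+ n + h * (- c + y) ^+ n)
     + b * (g * (c + z) ^+ n + h * (- c + z) ^+ n)) / c.
Proof.
move=> c0; rewrite mulrDl -!mulrA -!binomial_sign_sum_subexp // !mulr_sumr.
by rewrite -big_split; apply: eq_bigr => k _ /=; ring.
Qed.

Lemma binomial_sign_sum_exp (K : fieldType) (n : nat) (g h f y : K) :
  f != 0 ->
  \sum_(0 <= k < n.+1)
     'C(n, k)%:R * f ^ (k%:Z - 1) * (g + (-1) ^+ (n - k) * h) * y ^+ k
  = (g * (1 + f * y) ^+ n + h * (- 1 + f * y) ^+ n) / f.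
Proof.
move=> f0; rewrite -binomial_sign_sum mulr_suml.
apply: eq_big_nat => k _.
by rewrite exprz_subn1 // expr1n exprMn; ring.
Qed.

(** * The two identities over a field where 2 is nonzero *)

Section Identities.
Variables (K : fieldType) (x s r : K).
Hypotheses (two0 : 2%:R != 0 :> K)
  (hs : s ^+ 2 = x ^+ 2 - 1) (hr : r ^+ 2 = x ^+ 2 + 4%:R)
  (adm : admissible x s r).

Let c := chebBase x r.
Let f := fibBase x s.
Let u := 2%:R * x ^+ 2 - 1.
Let v := 2%:R * x * s.

Let four_neq0 : 4%:R != 0 :> K.
Proof. by rewrite (natrM _ 2 2) mulf_neq0. Qed.

Let alphaD : alpha x s + beta x s = 2%:R * x.
Proof. by rewrite /alpha /beta; ring. Qed.

Let alphaM : alpha x s * beta x s = 1.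
Proof. by rewrite /alpha /beta mulrC -subr_sqr hs; ring. Qed.

Let alpha_sqr : alpha x s ^+ 2 = u + v.
Proof. by rewrite /alpha sqrrD hs /u /v; ring. Qed.

Let beta_sqr : beta x s ^+ 2 = u - v.
Proof. by rewrite /beta sqrrB hs /u /v; ring. Qed.

Let c_neq0 : c != 0. Proof. by case: adm. Qed.

Let v_neq0 : v != 0. Proof. by case: adm. Qed.

Let x2_neq0 : x ^+ 2 + 2%:R != 0. Proof. by case: adm. Qed.

Let x3_neq0 : x ^+ 3 + 2%:R * x != 0.
Proof. by case: adm => _; rewrite mulf_eq0 negb_or => /andP[]. Qed.

Let s_neq0 : s != 0.
Proof. by move: v_neq0; rewrite mulf_eq0 negb_or => /andP[]. Qed.

Let x_neq0 : x != 0.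
Proof. by move: v_neq0; rewrite !mulf_eq0 !negb_or => /andP[/andP[]]. Qed.

Let r_neq0 : r != 0.
Proof.
by move: c_neq0; rewrite /c /chebBase !mulf_eq0 !negb_or => /andP[/andP[]].
Qed.

Let xuE : 2%:R * x ^+ 3 - x = x * u.
Proof. by rewrite /u; ring. Qed.

Let u_neq0 : u != 0.
Proof.
apply: contra_neq c_neq0 => u0.
by rewrite /c /chebBase xuE u0 !(mulr0, mul0r).
Qed.

Let f_neq0 : f != 0.
Proof. by rewrite /f /fibBase mulf_neq0 ?invr_eq0 //; case: adm. Qed.

Let p := ((x + r) / 2%:R) ^+ 2.
Let q := ((x - r) / 2%:R) ^+ 2.

(** Binet for the roots (x + r)/2 and (x - r)/2 of t^2 - xt - 1, whose difference is r. *)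
Let fib_even k : (fibp K (2 * k)).[x] = (p ^+ k - q ^+ k) / r.
Proof.
apply: (canRL (mulfK r_neq0)); rewrite /p /q -!exprM mulrC.
rewrite -(@fibp_binet _ x); first by congr (_ * _); field.
- by field.
- have -> : (x + r) / 2%:R * ((x - r) / 2%:R) = (x ^+ 2 - r ^+ 2) / 4%:R.
    by field; rewrite ?two0 four_neq0.
  by rewrite hr; field; rewrite ?two0 four_neq0.
Qed.

Let chebT_even k : (chebT K (2 * k)).[x] =
  2%:R^-1 * (u + v) ^+ k + 2%:R^-1 * (u - v) ^+ k.
Proof.
rewrite -mulrDr mulrC.
apply: (canRL (mulfK two0)).
by rewrite mulrC (chebT_binet _ alphaD alphaM) !exprM alpha_sqr beta_sqr.
Qed.

(** The Binet exponent is 2k + 1, hence the extra factors alpha and beta; the divisor is alpha -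
    beta = 2s. *)
Let chebU_even k : (chebU K (2 * k)).[x] =
  alpha x s / (2%:R * s) * (u + v) ^+ k
  + - beta x s / (2%:R * s) * (u - v) ^+ k.
Proof.
rewrite ![_ / _ * _]mulrAC -mulrDl mulNr.
apply: (canRL (mulfK (mulf_neq0 two0 s_neq0))).
have -> : 2%:R * s = alpha x s - beta x s by rewrite /alpha /beta; ring.
rewrite mulrC (chebU_binet _ alphaD alphaM) !exprS !exprM.
by rewrite alpha_sqr beta_sqr.
Qed.

(** After cancellation v f = 2u / (x^2 + 2), while p = (x^2 + 2 + xr) / 2 and c = xur / (x^2 +
    2). *)
Let vfp : v * (f * p) = u + c.
Proof.
have -> : p = (x ^+ 2 + 2%:R + x * r) / 2%:R.
  by rewrite /p expr_div_n sqrrD hr; field; rewrite two0 four_neq0.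
rewrite /v /f /u /c /fibBase /chebBase; field.
by rewrite two0 x2_neq0 x3_neq0 s_neq0.
Qed.

Let vfq : v * (f * q) = u - c.
Proof.
have -> : q = (x ^+ 2 + 2%:R - x * r) / 2%:R.
  by rewrite /q expr_div_n sqrrB hr; field; rewrite two0 four_neq0.
rewrite /v /f /u /c /fibBase /chebBase; field.
by rewrite two0 x2_neq0 x3_neq0 s_neq0.
Qed.

(* Both sides reduce to (x^2 + 2) / (2 u r). *)
Let coefE : (v * f * r)^-1 = x / (2%:R * c).
Proof.
rewrite /v /f /c /fibBase /chebBase; field.
rewrite xuE -/u (mulf_neq0 x_neq0 u_neq0).
by rewrite x2_neq0 r_neq0 two0 s_neq0 x3_neq0 u_neq0 x_neq0.
Qed.

(** Evaluates both right-hand sides: (g, h) is (1, 1) for T and (alpha, -beta) for U. *)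
Let fib_sum n g h :
  \sum_(1 <= k < n.+1)
     'C(n, k)%:R * f ^ (k%:Z - 1) * (g + (-1) ^+ (n - k) * h)
     * (fibp K (2 * k)).[x]
  = v ^- n * (v * (x / (2%:R * c)))
    * (g * ((u + v + c) ^+ n - (u + v - c) ^+ n)
       + h * ((u - v + c) ^+ n - (u - v - c) ^+ n)).
Proof.
transitivity (\sum_(0 <= k < n.+1)
     'C(n, k)%:R * f ^ (k%:Z - 1) * (g + (-1) ^+ (n - k) * h)
     * (fibp K (2 * k)).[x]).
  (* The term k = 0 can be added because F_0 = 0. *)
  by rewrite [RHS]big_nat_recl // muln0 horner0 mulr0 add0r big_add1.
under eq_bigr do rewrite fib_even mulrA mulrBr mulrBl.
rewrite sumrB -!mulr_suml !binomial_sign_sum_exp //.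
(* Pulling v out of each base turns 1 + f p into (v + u + c) / v, and similarly for q and for -1. *)
have hp e y z : v * (f * y) = z -> (e + f * y) ^+ n = v ^- n * (v * e + z) ^+ n.
  by move=> <-; rewrite -mulrDr (exprMn _ v) mulKf // expf_neq0.
rewrite !(hp _ _ _ vfp) !(hp _ _ _ vfq) -coefE.
rewrite !mulr1 !mulrN1.
have e1 : v + (u + c) = u + v + c by ring.
have e2 : v + (u - c) = u + v - c by ring.
have e3 : - v + (u + c) = u - v + c by ring.
have e4 : - v + (u - c) = u - v - c by ring.
rewrite e1 e2 e3 e4; field.
by rewrite r_neq0 f_neq0 v_neq0 expf_neq0.
Qed.

Lemma chebT_fib_sum n :
  x * (\sum_(0 <= k < n)
         'C(n, k)%:R * chebBase x r ^ (n%:Z - k%:Z - 1)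
         * (1 - (-1) ^+ (n - k)) * (chebT K (2 * k)).[x])
  = (2%:R * x * s) ^ (n%:Z - 1)
    * (\sum_(1 <= k < n.+1)
         'C(n, k)%:R * fibBase x s ^ (k%:Z - 1)
         * (1 + (-1) ^+ (n - k)) * (fibp K (2 * k)).[x]).
Proof.
rewrite -/c -/f -/v.
have -> : \sum_(0 <= k < n)
    'C(n, k)%:R * c ^ (n%:Z - k%:Z - 1)
    * (1 - (-1) ^+ (n - k)) * (chebT K (2 * k)).[x]
  = \sum_(0 <= k < n.+1)
    'C(n, k)%:R * c ^ (n%:Z - k%:Z - 1)
    * (1 + (-1) ^+ (n - k) * -1) * (chebT K (2 * k)).[x].
  (* The added term k = n vanishes, since 1 - (-1)^0 = 0. *)
  rewrite [RHS]big_nat_recr //= subnn expr0 mul1r (subrr 1) mulr0 mul0r addr0.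
  by under [RHS]eq_bigr do rewrite mulrN1.
under [in LHS]eq_bigr do rewrite chebT_even.
rewrite binomial_sign_sum_subexp2 //.
under [in RHS]eq_bigr do rewrite -[X in 1 + X]mulr1.
rewrite fib_sum exprz_subn1 // ![c + _]addrC ![- c + _]addrC; field.
by rewrite two0 c_neq0 v_neq0 expf_neq0.
Qed.

Lemma chebU_fib_sum n :
  1 / 2%:R * (\sum_(0 <= k < n.+1)
         'C(n, k)%:R * chebBase x r ^ (n%:Z - k%:Z - 1)
         * (1 - (-1) ^+ (n - k)) * (chebU K (2 * k)).[x])
  = (2%:R * x * s) ^ (n%:Z - 2)
    * (\sum_(1 <= k < n.+1)
         'C(n, k)%:R * fibBase x s ^ (k%:Z - 1)
         * (alpha x s - (-1) ^+ (n - k) * beta x s)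
         * (fibp K (2 * k)).[x]).
Proof.
rewrite -/c -/f -/v.
under [in LHS]eq_bigr do rewrite chebU_even -[X in 1 - X]mulr1 -mulrN.
under [in RHS]eq_bigr do rewrite -mulrN.
rewrite binomial_sign_sum_subexp2 // fib_sum.
rewrite (_ : n%:Z - 2 = n%:Z - 1 - 1); last by ring.
rewrite expfzDr // exprz_subn1 // ![c + _]addrC ![- c + _]addrC.
(* With x = v / (2s), the coefficient supplies the second power of v needed against v^(n-2), and the
   2s of [chebU_even]. *)
have -> : x / (2%:R * c) = v / (2%:R * s) / (2%:R * c).
  by rewrite /v; field; rewrite two0 s_neq0 c_neq0.
rewrite exprN1; field.
by rewrite two0 c_neq0 s_neq0 v_neq0 expf_neq0.
Qed.

End Identities.

(** The listed points are the zeros of x, x^2 - 1, 2x^2 - 1, x^2 + 4 and x^2 + 2; away from them x,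
    s, u, r and x^2 + 2 are nonzero, and the four conditions involve only these factors. *)
Lemma admissible_notin (C : numClosedFieldType) (x s r : C) :
  s ^+ 2 = x ^+ 2 - 1 -> r ^+ 2 = x ^+ 2 + 4%:R ->
  x \notin [:: 0; 1; -1; 1 / sqrtC 2%:R; - (1 / sqrtC 2%:R);
               2%:R * 'i; - (2%:R * 'i);
               'i * sqrtC 2%:R; - ('i * sqrtC 2%:R)] ->
  admissible x s r.
Proof.
move=> hs hr.
have sqr_neq0 (z y : C) : x != y -> x != - y -> y ^+ 2 = z -> x ^+ 2 - z != 0.
  by move=> h1 h2 <-; rewrite subr_eq0 eqf_sqr negb_or h1.
rewrite !inE !negb_or => /and5P[x0 x1 x1' xh /and5P[xh' x2 x2' xs xs']].
have two0 : 2%:R != 0 :> C by rewrite pnatr_eq0.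
have s0 : s != 0 by rewrite -sqrf_eq0 hs (sqr_neq0 _ 1) ?expr1n.
have r0 : r != 0.
  rewrite -sqrf_eq0 hr -[4%:R]opprK (sqr_neq0 _ (2%:R * 'i)) //.
  by rewrite exprMn sqrCi; ring.
have x20 : x ^+ 2 + 2%:R != 0.
  rewrite -[2%:R]opprK (sqr_neq0 _ ('i * sqrtC 2%:R)) //.
  by rewrite exprMn sqrCi sqrtCK mulN1r.
have u0 : 2%:R * x ^+ 2 - 1 != 0.
  have -> : 2%:R * x ^+ 2 - 1 = 2%:R * (x ^+ 2 - 2%:R^-1) by field.
  rewrite mulf_neq0 // (sqr_neq0 _ (1 / sqrtC 2%:R)) //.
  by rewrite expr_div_n sqrtCK expr1n div1r.
split=> //.
- by rewrite (_ : x ^+ 3 + _ = x * (x ^+ 2 + 2%:R)) ?mulf_neq0 //; ring.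
- rewrite /chebBase (_ : _ - x = x * (2%:R * x ^+ 2 - 1)); last by ring.
  by rewrite !mulf_neq0 ?invr_eq0.
- by rewrite !mulf_neq0.
Qed.

(* MathComp world; [^] is the power with integer exponents (0 ^ 0 = 1). *)
Theorem theorem7 (R : realType) (n : nat) (x s r : R[i])
    (hs : s ^+ 2 = x ^+ 2 - 1) (hr : r ^+ 2 = x ^+ 2 + 4%:R) :
  (x \notin [:: 0; 1; -1; 1 / sqrtC 2%:R; - (1 / sqrtC 2%:R);
                2%:R * 'i; - (2%:R * 'i);
                'i * sqrtC 2%:R; - ('i * sqrtC 2%:R)] ->
   admissible x s r) /\
  (admissible x s r ->
   x * (\sum_(0 <= k < n)
          'C(n, k)%:R * chebBase x r ^ (n%:Z - k%:Z - 1)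
          * (1 - (-1) ^+ (n - k)) * (chebT R[i] (2 * k)).[x])
   = (2%:R * x * s) ^ (n%:Z - 1)
     * (\sum_(1 <= k < n.+1)
          'C(n, k)%:R * fibBase x s ^ (k%:Z - 1)
          * (1 + (-1) ^+ (n - k)) * (fibp R[i] (2 * k)).[x])
   /\
   1 / 2%:R * (\sum_(0 <= k < n.+1)
          'C(n, k)%:R * chebBase x r ^ (n%:Z - k%:Z - 1)
          * (1 - (-1) ^+ (n - k)) * (chebU R[i] (2 * k)).[x])
   = (2%:R * x * s) ^ (n%:Z - 2)
     * (\sum_(1 <= k < n.+1)
          'C(n, k)%:R * fibBase x s ^ (k%:Z - 1)
          * (alpha x s - (-1) ^+ (n - k) * beta x s)
          * (fibp R[i] (2 * k)).[x])).
Proof.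
split; first exact: admissible_notin.
have two0 : 2%:R != 0 :> R[i] by rewrite pnatr_eq0.
by move=> adm; split; [apply: chebT_fib_sum | apply: chebU_fib_sum].
Qed.
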